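(* Let $p$ be a prime, $q$ a power of $p$, and let $\sigma$ be an involution of the field $\overline{\mathbb{F}_q}$. For any integer $n\ge 4$, the unitary group $\mathrm{U}(n,\overline{\mathbb{F}_q})$ (defined using $\sigma$) is not acceptable.
   Context: $\overline{\mathbb{F}_q}$ denotes an algebraic closure of the finite field $\mathbb{F}_q$. An involution $\sigma$ of $\overline{\mathbb{F}_q}$ means a field automorphism with $\sigma\circ\sigma=\mathrm{id}$. For a matrix $A$ over $\overline{\mathbb{F}_q}$, $\overline{A}$ is the matrix obtained by applying $\sigma$ to all entries. Let $J$ be the $n\times n$ matrix with $1$'s on the antidiagonal and $0$ elsewhere. Then $\mathrm{U}(n,\overline{\mathbb{F}_q})=\{A\in\mathrm{GL}(n,\overline{\mathbb{F}_q}) : {}^t\overline{A}JA=J\}$. Let $\Gamma$ be a group and $H$ a finite group. Two homomorphisms $\phi_1,\phi_2:H\to\Gamma$ are element-conjugate if for every $x\in H$ there is $h(x)\in\Gamma$ with $\phi_1(x)=h(x)^{-1}\phi_2(x)h(x)$; they are globally conjugate if one can choose a single $h\in\Gamma$ with $\phi_1(x)=h^{-1}\phi_2(x)h$ for all $x\in H$. The group $\Gamma$ is acceptable if for every finite group $H$, any two element-conjugate homomorphisms $H\to\Gamma$ are globally conjugate. *)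

(* Defs.v *)
From HB Require Import structures.
From mathcomp Require Import all_boot all_order all_algebra all_fingroup all_field.

Set Implicit Arguments.
Unset Strict Implicit.
Unset Printing Implicit Defensive.

Import GRing.Theory.
Local Open Scope ring_scope.

Section Acceptable.
Local Open Scope group_scope.

(* Recall that x ^ h is h^-1 * (x * h). *)
Definition element_conjugate (H G : groupType)
    (phi1 phi2 : {multiplicative H -> G}) : Prop :=
  forall x : H, exists h : G, phi1 x = phi2 x ^ h.

Definition globally_conjugate (H G : groupType)
    (phi1 phi2 : {multiplicative H -> G}) : Prop :=
  exists h : G, forall x : H, phi1 x = phi2 x ^ h.

Definition acceptable (G : groupType) : Prop :=
  forall (H : finGroupType) (phi1 phi2 : {multiplicative H -> G}),
    element_conjugate phi1 phi2 -> globally_conjugate phi1 phi2.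

End Acceptable.

Definition antidiag_mx (K : fieldType) (n : nat) : 'M[K]_n :=
  \matrix_(i, j) (j == rev_ord i)%:R.

Definition is_unitary (K : fieldType) (sigma : {rmorphism K -> K}) (n : nat)
    (A : 'M[K]_n) : bool :=
  (A \in unitmx)
  && ((map_mx sigma A)^T *m antidiag_mx K n *m A == antidiag_mx K n).

Record unitary (K : fieldType) (sigma : {rmorphism K -> K}) (n : nat) :=
  Unitary { unitary_val :> 'M[K]_n; _ : is_unitary sigma unitary_val }.

Section UnitaryGroup.
Variables (K : fieldType) (sigma : {rmorphism K -> K}) (n : nat).
Local Notation U := (unitary sigma n).

HB.instance Definition _ := [isSub for @unitary_val K sigma n].
HB.instance Definition _ := [Choice of U by <:].

Fact is_unitary1 : is_unitary sigma (1%:M : 'M[K]_n).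
Proof. by rewrite /is_unitary unitmx1 map_mx1 trmx1 mul1mx mulmx1 eqxx. Qed.

Fact is_unitaryM (A B : U) : is_unitary sigma (val A *m val B).
Proof.
have /andP[uA /eqP eA] := valP A; have /andP[uB /eqP eB] := valP B.
rewrite /is_unitary unitmx_mul uA uB map_mxM trmx_mul /=.
by rewrite -{2}eB -[X in _ == _ *m X *m _]eA !mulmxA.
Qed.

Fact is_unitaryV (A : U) : is_unitary sigma (invmx (val A)).
Proof.
have /andP[uA /eqP eA] := valP A.
rewrite /is_unitary unitmx_inv uA /= -{1}eA !mulmxA.
by rewrite -trmx_mul -map_mxM mulmxV // map_mx1 trmx1 mul1mx mulmxK.
Qed.

Definition unitary_one : U := Unitary is_unitary1.
Definition unitary_mul (A B : U) : U := Unitary (is_unitaryM A B).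
Definition unitary_inv (A : U) : U := Unitary (is_unitaryV A).

Fact unitary_mulA : associative unitary_mul.
Proof. by move=> A B C; apply: val_inj; apply: mulmxA. Qed.
Fact unitary_mul1 : left_id unitary_one unitary_mul.
Proof. by move=> A; apply: val_inj; apply: mul1mx. Qed.
Fact unitary_mulr1 : right_id unitary_one unitary_mul.
Proof. by move=> A; apply: val_inj; apply: mulmx1. Qed.
Fact unitary_mulV : left_inverse unitary_one unitary_inv unitary_mul.
Proof.
by move=> A; apply: val_inj; apply: mulVmx; case/andP: (valP A).
Qed.
Fact unitary_mulrV : right_inverse unitary_one unitary_inv unitary_mul.
Proof.
by move=> A; apply: val_inj; apply: mulmxV; case/andP: (valP A).
Qed.

HB.instance Definition _ := isGroup.Build U
  unitary_mulA unitary_mul1 unitary_mulr1 unitary_mulV unitary_mulrV.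

End UnitaryGroup.

(* Main.v *)
From HB Require Import structures.
Require Import Defs.
From mathcomp Require Import all_boot all_order all_algebra all_fingroup all_field.
From mathcomp Require Import ring.

(** Two features of characteristic p are exploited: unipotent elements have
    finite order, and two additive maps from an elementary abelian p-group to K
    can vanish at the same elements without being proportional.

    On the span of the first two and last two basis vectors, J is the tensor
    product of two symplectic planes, up to a sign of one basis vector. The
    tensor product of two upper unitriangular 2 x 2 matrices, with off-diagonal
    entries f and g, thus gives a matrix [unip f g] that preserves J, and
    (f, g) |-> [unip f g] turns sums into products. When f and g are fixed by sigma this is an element of
    the unitary group. Extending by the identity, the same works for all n >= 4,
    in every characteristic.

    Let H = (Z/p)^2. Pick t fixed by sigma but outside the prime field, and put
    f0 (x, y) = x + y t, f = f0 ^ p and g = f ^ p, which are additive maps from H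
    to the fixed field of sigma. The two homomorphisms are [unip f f] and
    [unip f g].

    - They are element-conjugate: a diagonal matrix rescales g by any nonzero
      square s ^ 2 while keeping f, and g h / f h = f0 h ^ (p (p - 1)) is the
      square of f0 h ^ 'C(p, 2), as soon as f0 h is nonzero; if f0 h = 0 both
      matrices are 1. Taking f to be f0 ^ p rather than f0 is what makes this
      exponent even for p = 2, so that no square root has to be extracted in
      the fixed field.

    - They are not globally conjugate: at (1, 0) and (0, 1), the nilpotent parts
      M and N of [unip f f] satisfy N = t ^ p M up to a term killed by M, hence
      M N = t ^ p M ^ 2, and this identity would be transported by conjugation;
      but it fails for [unip f g], as t ^ p <> t ^ (p ^ 2).

    The element t exists because otherwise every trace x + sigma x and every norm
    x sigma x would lie in the prime field, so that the Frobenius map would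
    permute the roots x and sigma x of a quadratic polynomial; then all x in K
    would satisfy x ^ (p ^ 2) = x, contradicting algebraic closedness. *)

Set Implicit Arguments.
Unset Strict Implicit.
Unset Printing Implicit Defensive.

Import GRing.Theory.
Local Open Scope ring_scope.

(** * Elements of the unitary group *)

Section UnitaryMatrices.
Variables (K : fieldType) (sigma : {rmorphism K -> K}) (n : nat).
Implicit Types (i j : 'I_n) (c : K) (X Y : 'M[K]_n).
Local Notation J := (antidiag_mx K n).

Lemma mul_antidiag_delta i j : J *m delta_mx i j = delta_mx (rev_ord i) j.
Proof.
apply/matrixP=> k l; rewrite !mxE (bigD1 i) //= !mxE eqxx /= big1 ?addr0.
  rewrite [i == _]eq_sym (can2_eq (@rev_ordK n) (@rev_ordK n)).
  by do 2 case: eqP; rewrite ?(mulr0, mul0r, mulr1).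
by move=> r /negPf ri; rewrite !mxE ri mulr0.
Qed.

Lemma mul_delta_antidiag i j : delta_mx i j *m J = delta_mx i (rev_ord j).
Proof.
apply/matrixP=> k l; rewrite !mxE (bigD1 j) //= !mxE eqxx andbT big1 ?addr0.
  by case: (k == i); case: (l == _); rewrite ?(mulr0, mul0r, mulr1).
by move=> r /negPf rj; rewrite !mxE rj andbF mul0r.
Qed.

(** Y is the adjoint of X for J; exhibiting it as an inverse of X avoids
    computing with the triple product. *)
Lemma adjoint_unitary X Y :
    map_mx sigma X = X -> X^T *m J = J *m Y -> Y *m X = 1%:M ->
  Defs.is_unitary sigma X.
Proof.
move=> sX XJ YX; have [_ uX] := mulmx1_unit YX.
by rewrite /Defs.is_unitary uX sX XJ -mulmxA YX mulmx1 eqxx.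
Qed.

(** The difference of a matrix unit and its adjoint for J: a root vector of the
    Lie algebra of the orthogonal group of J when j is neither i nor rev i. *)
Definition skew_unit i j : 'M[K]_n :=
  delta_mx i j - delta_mx (rev_ord j) (rev_ord i).

Lemma map_skew_unit i j : map_mx sigma (skew_unit i j) = skew_unit i j.
Proof. by rewrite map_mxB !map_delta_mx. Qed.

Lemma skew_unit_adjoint i j : (skew_unit i j)^T *m J = - (J *m skew_unit i j).
Proof.
rewrite /skew_unit linearB /= !trmx_delta mulmxBl mulmxBr.
by rewrite !mul_antidiag_delta !mul_delta_antidiag !rev_ordK opprB.
Qed.

(** The matrix is the exponential of a skew-adjoint matrix of square zero, so
    its adjoint is its inverse. *)
Lemma unipotent_unitary i j c :
    skew_unit i j *m skew_unit i j = 0 -> sigma c = c ->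
  Defs.is_unitary sigma (1%:M + c *: skew_unit i j).
Proof.
set E := skew_unit i j => EE sc.
apply: (@adjoint_unitary _ (1%:M - c *: E)).
- by rewrite map_mxD map_mxZ map_mx1 sc map_skew_unit.
- rewrite linearD linearZ /= trmx1 mulmxDl mulmxBr mul1mx mulmx1.
  by rewrite -scalemxAl -scalemxAr skew_unit_adjoint scalerN.
rewrite mulmxBl mul1mx mulmxDr mulmx1 -scalemxAl -scalemxAr EE !scaler0 addr0.
by rewrite addrK.
Qed.

Lemma diag_unitary (d : 'I_n -> K) :
    (forall i, sigma (d i) = d i) -> (forall i, d (rev_ord i) * d i = 1) ->
  Defs.is_unitary sigma (diag_mx (\row_i d i)).
Proof.
move=> sd dd; apply: (@adjoint_unitary _ (diag_mx (\row_i d (rev_ord i)))).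
- by rewrite map_diag_mx; congr diag_mx; apply/rowP=> i; rewrite !mxE sd.
- rewrite tr_diag_mx mul_diag_mx mul_mx_diag; apply/matrixP=> i j.
  rewrite !mxE; have [->|_] := eqVneq j (rev_ord i); last by rewrite mulr0 mul0r.
  by rewrite rev_ordK mulrC.
rewrite mul_mx_diag; apply/matrixP=> i j; rewrite !mxE.
by have [->|_] := eqVneq i j; rewrite ?mul0r //= !mulr1n dd.
Qed.

(** * A two-parameter unipotent group *)

Section RootPair.
Variables (a b : 'I_n).
Hypothesis abU : uniq [:: a; b; rev_ord b; rev_ord a].

(** The root vectors of weights e_a - e_b and e_a + e_b; the sum of these roots
    is not a root, whence the commutation of [rootm] and [rootp]. *)
Let rootm := skew_unit a b.
Let rootp := skew_unit b (rev_ord a).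

Definition corner_mx : 'M[K]_n := delta_mx a (rev_ord a).

Let ab_neq :
  (a == b = false) * (a == rev_ord b = false) * (a == rev_ord a = false)
  * (b == rev_ord b = false) * (b == rev_ord a = false)
  * (rev_ord b == rev_ord a = false)
  * ((b == a = false) * (rev_ord b == a = false) * (rev_ord a == a = false)
  * (rev_ord b == b = false) * (rev_ord a == b = false)
  * (rev_ord a == rev_ord b = false)).
Proof.
move: abU; rewrite /= !inE !negb_or.
rewrite !(eq_sym _ a) !(eq_sym _ b) !(eq_sym (rev_ord a)).
case/and4P=> [/and3P[/negPf-> /negPf-> /negPf->] /andP[/negPf-> /negPf->]].
by move=> /negPf->.
Qed.

Lemma root_mulmx :
  [/\ rootm *m rootm = 0, rootp *m rootp = 0,
      rootm *m rootp = corner_mx, rootp *m rootm = corner_mx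
    & (rootm *m corner_mx = 0) * (rootp *m corner_mx = 0)
      * (corner_mx *m rootm = 0) * (corner_mx *m rootp = 0)
      * (corner_mx *m corner_mx = 0)].
Proof.
rewrite /rootm /rootp /corner_mx /skew_unit !rev_ordK.
rewrite ?(mulmxBl, mulmxBr) !mul_delta_mx_cond !eqxx !ab_neq /=.
by rewrite ?(mulr0n, subr0, sub0r, subrr, opprK).
Qed.

(** In the basis a, b, rev b, rev a this is the tensor product of the
    unitriangular 2 x 2 matrices with entries f and g, after changing the sign
    of one basis vector so that the form becomes J. *)
Definition unip f g : 'M[K]_n := (1%:M + f *: rootp) *m (1%:M + g *: rootm).

Lemma unipE f g :
  unip f g = 1%:M + (f *: rootp + g *: rootm + (f * g) *: corner_mx).
Proof.
have [_ _ _ BA _] := root_mulmx.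
rewrite /unip mulmxDr mulmx1 mulmxDl mul1mx -scalemxAr -scalemxAl BA scalerA.
by rewrite !addrA mulrC.
Qed.

Lemma unip_sub1_mul f g f' g' :
  (unip f g - 1%:M) *m (unip f' g' - 1%:M) = (f * g' + g * f') *: corner_mx.
Proof.
have [AA BB AB BA CC] := root_mulmx.
rewrite !unipE ![1%:M + _]addrC !addrK !(mulmxDl, mulmxDr).
rewrite -!(scalemxAl, scalemxAr) AA BB AB BA !CC.
by rewrite !(scaler0, addr0, add0r) !scalerA -scalerDl.
Qed.

Lemma unipD f g f' g' : unip f g *m unip f' g' = unip (f + f') (g + g').
Proof.
rewrite -[unip f g](subrK 1%:M) -[unip f' g'](subrK 1%:M).
rewrite mulmxDl mulmxDr mul1mx mulmx1 unip_sub1_mul !unipE.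
by apply/matrixP => i j; rewrite !mxE; ring.
Qed.

Lemma unip_unitary f g :
  sigma f = f -> sigma g = g -> Defs.is_unitary sigma (unip f g).
Proof.
have [AA BB _ _ _] := root_mulmx; move=> sf sg.
exact: (is_unitaryM (Unitary (unipotent_unitary BB sf))
                    (Unitary (unipotent_unitary AA sg))).
Qed.

(** The torus element diag(s, 1/s, s, 1/s) centralises the first factor of
    [unip] and acts on the second one by the root value s ^ 2. *)
Definition torus s : 'M[K]_n :=
  diag_mx (\row_i (if i \in [:: a; rev_ord b] then s
                   else if i \in [:: b; rev_ord a] then s^-1 else 1)).

Lemma torus_unitary s :
  s != 0 -> sigma s = s -> Defs.is_unitary sigma (torus s).
Proof.
move=> s0 ss; apply: diag_unitary => i.
  by do 2?case: ifP => // _; rewrite ?fmorphV ?ss ?rmorph1.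
rewrite !inE !(inj_eq (@rev_ord_inj n)) !(can2_eq (@rev_ordK n) (@rev_ordK n)).
have [->|ia] := eqVneq i a; first by rewrite !ab_neq /= mulVf.
have [->|ib] := eqVneq i b; first by rewrite !ab_neq /= mulfV.
have [->|ib'] := eqVneq i (rev_ord b); first by rewrite !ab_neq /= mulVf.
by case: eqP => _; rewrite ?mulfV ?mulr1.
Qed.

Lemma torus_unip s f g : s != 0 ->
  torus s *m unip f g = unip f (s ^+ 2 * g) *m torus s.
Proof.
move=> s0.
have Td i j : torus s *m delta_mx i j = (torus s i i) *: delta_mx i j.
  rewrite /torus mul_diag_mx; apply/matrixP=> k l; rewrite !mxE eqxx.
  by have [->|_] := eqVneq k i; rewrite ?mulr0.
have dT i j : delta_mx i j *m torus s = (torus s j j) *: delta_mx i j.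
  rewrite /torus mul_mx_diag; apply/matrixP=> k l; rewrite !mxE eqxx.
  by have [->|_] := eqVneq l j; rewrite ?andbF ?mulr0 ?mul0r // mulrC.
have Ta : torus s a a = s by rewrite !mxE !inE !eqxx.
have Tb : torus s b b = s^-1 by rewrite !mxE !inE !ab_neq !eqxx.
have Tb' : torus s (rev_ord b) (rev_ord b) = s by rewrite !mxE !inE !eqxx orbT.
have Ta' : torus s (rev_ord a) (rev_ord a) = s^-1.
  by rewrite !mxE !inE !ab_neq !eqxx.
have TA : torus s *m rootm = (s ^+ 2) *: rootm *m torus s.
  rewrite /rootm /skew_unit -scalemxAl !(mulmxBl, mulmxBr) !Td !dT.
  by rewrite Ta Tb Tb' Ta' -!scalerBr scalerA expr2 mulfK.
have TB : torus s *m rootp = rootp *m torus s.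
  rewrite /rootp /skew_unit rev_ordK !(mulmxBl, mulmxBr) !Td !dT.
  by rewrite Ta Tb Tb' Ta'.
have TfB : torus s *m (1%:M + f *: rootp) = (1%:M + f *: rootp) *m torus s.
  by rewrite mulmxDl mulmxDr mulmx1 mul1mx -scalemxAr TB scalemxAl.
rewrite /unip mulmxA TfB -!mulmxA; congr (_ *m _).
rewrite mulmxDl mulmxDr mulmx1 mul1mx -scalemxAr TA -!scalemxAl scalerA.
by rewrite [g * _]mulrC.
Qed.

(** With M and N the nilpotent parts of the first and second matrix of a pair,
    M N = u M ^ 2 holds for the pair (unip 1 1, unip u u), while for the pair
    (unip 1 1, unip u v) the difference of the two sides is (v - u) times
    [corner_mx]. Conjugation by h preserves such relations. *)
Lemma unip_conj_proportional (h : 'M[K]_n) u v : h \in unitmx ->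
    h *m unip 1 1 = unip 1 1 *m h -> h *m unip u u = unip u v *m h ->
  u = v.
Proof.
move=> uh h1 hu.
pose M := unip 1 1 - 1%:M; pose N w := unip u w - 1%:M.
have hM : h *m M = M *m h by rewrite mulmxBr mulmxBl mulmx1 mul1mx h1.
have hN : h *m N u = N v *m h by rewrite mulmxBr mulmxBl mulmx1 mul1mx hu.
have hMM : h *m (M *m M) = M *m M *m h by rewrite mulmxA hM -!mulmxA hM.
have hMN : h *m (M *m N u) = M *m N v *m h by rewrite mulmxA hM -!mulmxA hN.
move: hMM hMN; rewrite !unip_sub1_mul -!scalemxAr -!scalemxAl !mul1r => hC hCu.
have Ch0 : (v - u) *: (corner_mx *m h) = 0.
  transitivity ((v + u) *: (corner_mx *m h)
                - u *: ((1 + 1) *: (corner_mx *m h))).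
    by rewrite scalerA -scalerBl; congr (_ *: _); ring.
  rewrite -hCu -hC scalerA -scalerBl; apply/eqP; rewrite scaler_eq0.
  by apply/orP; left; apply/eqP; ring.
apply/eqP; rewrite eq_sym -subr_eq0; apply: contraT => uv.
have : corner_mx = 0.
  move/eqP: Ch0; rewrite scaler_eq0 (negPf uv) => /eqP Ch.
  by rewrite -(mulmxK uh corner_mx) Ch mul0mx.
move/matrixP/(_ a (rev_ord a)); rewrite !mxE !eqxx => /eqP.
by rewrite oner_eq0.
Qed.

Section Morphism.
Variables (H : finGroupType) (f g : H -> K).
Hypothesis fM : forall x y, f (x * y)%g = f x + f y.
Hypothesis gM : forall x y, g (x * y)%g = g x + g y.
Hypothesis sf : forall x, sigma (f x) = f x.
Hypothesis sg : forall x, sigma (g x) = g x.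

Definition unip_fun x : unitary sigma n := Unitary (unip_unitary (sf x) (sg x)).

Fact unip_funM : {morph unip_fun : x y / (x * y)%g}.
Proof. by move=> x y; apply: val_inj; rewrite /= fM gM unipD. Qed.

Definition unip_mor : {multiplicative H -> unitary sigma n} :=
  HB.pack unip_fun (isMultiplicative.Build H _ unip_fun unip_funM).

End Morphism.

End RootPair.

End UnitaryMatrices.

(** * Fields of characteristic p *)

Lemma exists_fixed_not_prime (K : closedFieldType) (p : nat)
    (sigma : {rmorphism K -> K}) :
    p \in [pchar K] -> involutive sigma ->
  exists2 t, sigma t = t & t ^+ p != t.
Proof.
move=> chK sigma_invol.
have [x xP] : exists x : K, x ^+ (p ^ 2) != x.
  have p2_gt1 : (1 < p ^ 2)%N.
    by rewrite -(exp1n 2) ltn_exp2r // prime_gt1 // (pcharf_prime chK).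
  (* A root of 'X^(p ^ 2) = 'X + 1. *)
  have [x xE] :=
    @solve_monicpoly K (p ^ 2)%N (fun i => (i < 2)%:R) (ltnW p2_gt1).
  exists x; rewrite xE.
  case: (p ^ 2)%N p2_gt1 => [|[|m]] // _.
  rewrite !big_ord_recl big1 => [|i _]; last by rewrite mul0r.
  by rewrite /= expr0 expr1 !mul1r addr0 -subr_eq0 addrK oner_neq0.
have [tP|] := eqVneq ((x + sigma x) ^+ p) (x + sigma x); last first.
  by exists (x + sigma x); rewrite // rmorphD sigma_invol addrC.
have [nP|] := eqVneq ((x * sigma x) ^+ p) (x * sigma x); last first.
  by exists (x * sigma x); rewrite // rmorphM sigma_invol mulrC.
have FrD (y z : K) : (y + z) ^+ p = y ^+ p + z ^+ p.
  by rewrite -!(pFrobenius_autE chK) rmorphD.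
(* x ^+ p is a root of the quadratic polynomial with roots x and sigma x, since
   raising to the power p preserves its coefficients. *)
have : (x ^+ p - x) * (x ^+ p - sigma x) = 0.
  have -> : (x ^+ p - x) * (x ^+ p - sigma x)
     = x ^+ p * x ^+ p - (x + sigma x) * x ^+ p + x * sigma x by ring.
  by rewrite -tP -nP FrD exprMn; ring.
case/eqP; rewrite mulf_eq0 !subr_eq0 => /orP[]/eqP xp; case/eqP: xP.
  by rewrite expnS expn1 exprM !xp.
by rewrite expnS expn1 exprM xp -rmorphXn xp sigma_invol.
Qed.

Lemma natr_FpD (R : nzRingType) (p : nat) (chR : p \in [pchar R])
    (x y : 'F_p) :
  (x + y)%R%:R = x%:R + y%:R :> R.
Proof.
have p_prime := pcharf_prime chR.
by rewrite -natrD -(GRing.natr_mod_pchar chR (x + y)) /= [X in (_ %% X)%N]Fp_cast.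
Qed.

(** * The two homomorphisms *)

Theorem unitary_not_acceptable (K : closedFieldType) (p : nat)
    (sigma : {rmorphism K -> K}) (n : nat) :
    p \in [pchar K] -> involutive sigma -> (4 <= n)%N ->
  ~ acceptable (unitary sigma n).
Proof.
move=> chK sigma_invol; case: n => [|[|[|[|m]]]] // _ acc; set n := m.+4 in acc.
have [t st tp] := exists_fixed_not_prime chK sigma_invol.
have p_prime := pcharf_prime chK.
pose a : 'I_n := @Ordinal n 0 isT; pose b : 'I_n := @Ordinal n 1 isT.
have abU : uniq [:: a; b; rev_ord b; rev_ord a].
  by rewrite -(map_inj_uniq val_inj) /= !subSS !subn0 !inE /= ltn_eqF.
have FrD (y z : K) : (y + z) ^+ p = y ^+ p + z ^+ p.
  by rewrite -!(pFrobenius_autE chK) rmorphD.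
pose H : finGroupType := ('F_p * 'F_p)%type.
pose f0 (x : H) : K := x.1%:R + x.2%:R * t.
pose f x := f0 x ^+ p; pose g x := f x ^+ p.
have f0M x y : f0 (x * y)%g = f0 x + f0 y.
  by rewrite /f0 /= !natr_FpD //; ring.
have fM x y : f (x * y)%g = f x + f y by rewrite /f f0M FrD.
have gM x y : g (x * y)%g = g x + g y by rewrite /g fM FrD.
have sf0 x : sigma (f0 x) = f0 x by rewrite rmorphD rmorphM !rmorph_nat st.
have sf x : sigma (f x) = f x by rewrite rmorphXn /= sf0.
have sg x : sigma (g x) = g x by rewrite rmorphXn /= sf.
pose phi1 := unip_mor abU fM fM sf sf.
pose phi2 := unip_mor abU fM gM sf sg.
have ec : element_conjugate phi1 phi2.
  move=> x; have [f0x|f0x] := eqVneq (f0 x) 0.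
    exists 1%g; rewrite conjg1; apply: val_inj => /=.
    have p0 : (p == 0)%N = false by rewrite eqn0Ngt prime_gt0.
    by rewrite /g /f f0x expr0n p0 expr0n p0.
  pose s := f0 x ^+ 'C(p, 2).
  have s0 : s != 0 by rewrite expf_neq0.
  have ss : sigma s = s by rewrite rmorphXn /= sf0.
  have gE : g x = s ^+ 2 * f x.
    rewrite /g /f /s -!exprM -exprD; congr (_ ^+ _).
    by rewrite (bin_ffact p 2) /= ffactnS ffactn1 addnC -mulnS prednK ?prime_gt0.
  pose T : unitary sigma n := Unitary (torus_unitary abU s0 ss).
  exists T; rewrite conjgE; apply: (mulgI T); rewrite mulKVg.
  by apply: val_inj; rewrite /= gE torus_unip.
have [h hP] := acc H phi1 phi2 ec.
have hphi x : val h *m unip a b (f x) (f x) = unip a b (f x) (g x) *m val h.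
  have /(congr1 val)// : (h * phi1 x = phi2 x * h)%g.
  by rewrite hP conjgE mulKVg.
pose x1 : H := (1, 0); pose xt : H := (0, 1).
have f1 : f x1 = 1 by rewrite /f /f0 /= mul0r addr0 expr1n.
have g1 : g x1 = 1 by rewrite /g f1 expr1n.
have ft : f xt = t ^+ p by rewrite /f /f0 /= mul1r add0r.
have uh : val h \in unitmx by case/andP: (valP h).
move: (hphi x1) (hphi xt); rewrite f1 g1 => h1 ht.
have := unip_conj_proportional abU uh h1 ht.
(* Injectivity of the Frobenius map gives t = t ^+ p. *)
rewrite /g ft -!(pFrobenius_autE chK) => /fmorph_inj/eqP.
by rewrite eq_sym pFrobenius_autE (negPf tp).
Qed.

(* [K] with [iota] is an algebraic closure of the field [F] with q elements:
   [K] is algebraically closed and algebraic over the image of [F]. *)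
Theorem theorem5p3 (p k q : nat) (p_prime : prime p) (k_gt0 : (0 < k)%N)
    (q_def : q = (p ^ k)%N)
    (F : finFieldType) (card_F : #|F| = q)
    (K : closedFieldType) (iota : {rmorphism F -> K})
    (K_algebraic : integralRange iota)
    (sigma : {rmorphism K -> K}) (sigma_invol : involutive sigma)
    (n : nat) (n_ge4 : (4 <= n)%N) :
  ~ acceptable (unitary sigma n).
Proof.
have chF : p \in [pchar F] by apply: (card_finPcharP (n := k)); rewrite ?card_F.
have chK : p \in [pchar K] by rewrite (fmorph_pchar iota).
exact: unitary_not_acceptable chK sigma_invol n_ge4.
Qed.
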